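(* In the parameter space $\mathrm{NSub}(F_\infty)$, the set of $N$ such that $F_\infty/N$ is finite is $\Sigma^0_2$-complete. The same holds for rings (the set of $I\in\mathrm{Id}(R_\infty)$ with $R_\infty/I$ finite), abelian groups (the set of $H\in\mathrm{Sub}(\mathbb{Z}^{(\mathbb{N})})$ with $\mathbb{Z}^{(\mathbb{N})}/H$ finite) and lattices (the set of $\theta\in\mathrm{Con}_{\wedge,\vee}(L_\infty)$ with $L_\infty/\theta$ finite) in their respective parameter spaces.
   Context: $F_\infty$ is the free group on countably many generators and $\mathrm{NSub}(F_\infty)\subseteq 2^{F_\infty}$ the set of its normal subgroups; $R_\infty=\mathbb{Z}\langle X_n:n\in\mathbb{N}\rangle$ is the free unital ring on countably many non-commuting variables and $\mathrm{Id}(R_\infty)\subseteq 2^{R_\infty}$ its set of two-sided ideals; $\mathbb{Z}^{(\mathbb{N})}=\bigoplus_{n}\mathbb{Z}e_n$ and $\mathrm{Sub}(\mathbb{Z}^{(\mathbb{N})})\subseteq 2^{\mathbb{Z}^{(\mathbb{N})}}$ its set of subgroups; $L_\infty$ is the free lattice on countably many generators and $\mathrm{Con}_{\wedge,\vee}(L_\infty)\subseteq 2^{L_\infty\times L_\infty}$ its set of lattice congruences. Each is given the subspace topology of the product (Cantor) topology; all are closed, hence compact Polish. A subset $S$ of a Polish space $X$ is $\Sigma^0_2$-complete if $S$ is $\Sigma^0_2$ ($F_\sigma$) and for every $\Sigma^0_2$ subset $B$ of any Polish space $Y$ there is a continuous $f:Y\to X$ with $f^{-1}(S)=B$.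
   Formalization: In the definition of Σ⁰₂-complete, Y ranges over zero-dimensional Polish spaces instead of all Polish spaces; with Y = ℝ and B = {0} the literal claim fails, as continuous maps from ℝ to these totally disconnected spaces are constant. *)

(* Defs.v *)
From HB Require Import structures.
From mathcomp Require Import all_boot all_order all_algebra generic_quotient.
From mathcomp.multinomials Require Import monalg.
From mathcomp Require Import all_classical reals topology borel_hierarchy.

Set Implicit Arguments.
Unset Strict Implicit.
Unset Printing Implicit Defensive.

Import Order.TTheory GRing.Theory Num.Theory.

Local Open Scope classical_set_scope.
Local Open Scope quotient_scope.

Definition is_metric (R : realType) (T : Type) (d : T -> T -> R) : Prop :=
  [/\ forall x y, (0 <= d x y)%R,
      forall x y, d x y = 0%R <-> x = y,
      forall x y, d x y = d y x &
      forall x y z, (d x z <= d x y + d y z)%R].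

Definition metrizes (R : realType) (T : topologicalType) (d : T -> T -> R)
    : Prop :=
  forall (x : T) (A : set T),
    nbhs x A <-> exists2 e : R, (0 < e)%R & [set y | (d x y < e)%R] `<=` A.

Definition complete_metric (R : realType) (T : topologicalType)
    (d : T -> T -> R) : Prop :=
  forall u : nat -> T,
    (forall e : R, (0 < e)%R -> exists N : nat,
       forall m n : nat, (N <= m)%N -> (N <= n)%N -> (d (u m) (u n) < e)%R) ->
    exists l : T, u @ \oo --> l.

Definition polish (R : realType) (T : topologicalType) : Prop :=
  (exists2 D : set T, countable D & dense D) /\
  (exists d : T -> T -> R, [/\ is_metric d, metrizes d & complete_metric d]).

(* The library predicate [zero_dimensional] only asks that distinct points be
   separated by clopen sets, which is strictly weaker, even for Polish
   spaces. *)
Definition clopen_basis (T : topologicalType) : Prop := basis (@clopen T).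

(* Hardness is tested against zero-dimensional Polish spaces. Without
   [clopen_basis Y] no subset of a totally disconnected space could be complete:
   a continuous map from the real line to such a space is constant, so no proper
   nonempty F_sigma subset of the line is a preimage under it. *)
Definition Sigma02_complete (R : realType) (X : topologicalType) (S : set X)
    : Prop :=
  Fsigma S /\
  forall Y : topologicalType, polish R Y -> clopen_basis Y ->
  forall B : set Y, Fsigma B ->
  exists2 f : Y -> X, continuous f & f @^-1` S = B.

(* A letter [(n, false)] stands for the generator x_n, [(n, true)] for its
   inverse. *)
Notation letter := (nat * bool)%type.
Notation word := (seq letter).

Definition letterV (a : letter) : letter := (a.1, ~~ a.2).

Inductive word_equiv : word -> word -> Prop :=
| word_equiv_cancel u a v :
    word_equiv (u ++ a :: letterV a :: v) (u ++ v)
| word_equiv_refl u : word_equiv u u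
| word_equiv_sym u v : word_equiv u v -> word_equiv v u
| word_equiv_trans u v w : word_equiv u v -> word_equiv v w -> word_equiv u w.

Definition word_eqb (u v : word) : bool := `[< word_equiv u v >].

Lemma word_eqb_equiv : equiv_class_of word_eqb.
Proof.
split=> [u|u v|v u w].
- by apply/asboolP; exact: word_equiv_refl.
- by apply/asboolP/asboolP; exact: word_equiv_sym.
- by move=> /asboolP uv /asboolP vw; apply/asboolP; exact: word_equiv_trans vw.
Qed.

Canonical word_equiv_rel := EquivRelPack word_eqb_equiv.

Definition free_group : Type := {eq_quot word_equiv_rel}.

HB.instance Definition _ := Choice.on free_group.
HB.instance Definition _ := Countable.on free_group.

Definition fg_pi (u : word) : free_group := \pi_({eq_quot word_equiv_rel}) u.
Definition fg_repr (x : free_group) : word := repr (x : {eq_quot word_equiv_rel}).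

Lemma fg_reprK x : fg_pi (fg_repr x) = x.
Proof. exact: reprK. Qed.

Lemma fg_piP u v : fg_pi u = fg_pi v <-> word_equiv u v.
Proof.
by split=> [/(eqmodP word_equiv_rel u v)/asboolP //|/asboolP h]; exact/(eqmodP word_equiv_rel u v).
Qed.

Lemma word_equiv_repr u : word_equiv (fg_repr (fg_pi u)) u.
Proof. by apply/fg_piP; rewrite fg_reprK. Qed.

Lemma word_equiv_cat u u' v v' :
  word_equiv u u' -> word_equiv v v' -> word_equiv (u ++ v) (u' ++ v').
Proof.
move=> uu' vv'; apply: (@word_equiv_trans _ (u' ++ v)).
  elim: uu' => [p a q|p|p q _|p q r _ IH1 _ IH2].
  - by rewrite -!catA; exact: word_equiv_cancel.
  - exact: word_equiv_refl.
  - exact: word_equiv_sym.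
  - exact: word_equiv_trans IH2.
elim: vv' => [p a q|p|p q _|p q r _ IH1 _ IH2].
- by rewrite !catA; exact: word_equiv_cancel.
- exact: word_equiv_refl.
- exact: word_equiv_sym.
- exact: word_equiv_trans IH2.
Qed.

Definition wordV (u : word) : word := rev (map letterV u).

Lemma letterVK : involutive letterV.
Proof. by case=> n b; rewrite /letterV /= negbK. Qed.

Lemma wordVK : involutive wordV.
Proof.
move=> u; rewrite /wordV map_rev revK -map_comp map_id_in // => a _.
exact: letterVK.
Qed.

Lemma word_equivV u v : word_equiv u v -> word_equiv (wordV u) (wordV v).
Proof.
elim=> {u v} [p a q|p|p q _|p q r _ IH1 _ IH2].
- rewrite /wordV !map_cat !rev_cat /= !rev_cons -!cats1 -!catA /=.
  have := word_equiv_cancel (wordV q) (letterV (letterV a)) (wordV p).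
  by rewrite (letterVK (letterV a)).
- exact: word_equiv_refl.
- exact: word_equiv_sym.
- exact: word_equiv_trans IH2.
Qed.

Lemma word_equiv_mulV u : word_equiv (u ++ wordV u) [::].
Proof.
elim/last_ind: u => [|u a IH]; first exact: word_equiv_refl.
rewrite /wordV map_rcons rev_rcons cat_rcons -/(wordV u).
exact: word_equiv_trans (word_equiv_cancel _ _ _) IH.
Qed.

Definition fg_one : free_group := fg_pi [::].
Definition fg_mul (x y : free_group) : free_group :=
  fg_pi (fg_repr x ++ fg_repr y).
Definition fg_inv (x : free_group) : free_group := fg_pi (wordV (fg_repr x)).

Lemma fg_mulE u v : fg_mul (fg_pi u) (fg_pi v) = fg_pi (u ++ v).
Proof. by apply/fg_piP; apply: word_equiv_cat; exact: word_equiv_repr. Qed.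

Lemma fg_invE u : fg_inv (fg_pi u) = fg_pi (wordV u).
Proof. by apply/fg_piP; apply: word_equivV; exact: word_equiv_repr. Qed.

Lemma fg_mulA : associative fg_mul.
Proof.
move=> x y z; rewrite -(fg_reprK x) -(fg_reprK y) -(fg_reprK z).
by rewrite !fg_mulE catA.
Qed.

Lemma fg_mul1 : left_id fg_one fg_mul.
Proof. by move=> x; rewrite -(fg_reprK x) fg_mulE. Qed.

Lemma fg_mulr1 : right_id fg_one fg_mul.
Proof. by move=> x; rewrite -(fg_reprK x) fg_mulE cats0. Qed.

Lemma fg_mulrV : right_inverse fg_one fg_inv fg_mul.
Proof.
move=> x; rewrite -(fg_reprK x) fg_invE fg_mulE.
by apply/fg_piP; exact: word_equiv_mulV.
Qed.

Lemma fg_mulV : left_inverse fg_one fg_inv fg_mul.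
Proof.
move=> x; rewrite -(fg_reprK x) fg_invE fg_mulE; apply/fg_piP.
by rewrite -{2}(wordVK (fg_repr x)); exact: word_equiv_mulV.
Qed.

HB.instance Definition _ :=
  isGroup.Build free_group fg_mulA fg_mul1 fg_mulr1 fg_mulV fg_mulrV.

Definition fg_gen (n : nat) : free_group := fg_pi [:: (n, false)].

Section FreeGroupUniversal.
Local Open Scope group_scope.

Theorem free_group_universal (G : groupType) (g : nat -> G) :
  exists! f : free_group -> G,
    {morph f : x y / x * y} /\ forall n, f (fg_gen n) = g n.
Proof.
pose ev1 (a : letter) := if a.2 then (g a.1)^-1 else g a.1.
pose ev (u : word) := \prod_(a <- u) ev1 a.
have ev_eq u v : word_equiv u v -> ev u = ev v.
  elim=> {u v} [u a v|//|u v _ ->//|u v w _ -> _ ->//].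
  rewrite /ev !big_cat /= !big_cons mulgA -[in LHS]mulgA; congr (_ * _).
  case: a => n [] /=; rewrite /ev1 /=; first by rewrite mulKg.
  by rewrite mulVKg.
have ev_pi u : ev (fg_repr (fg_pi u)) = ev u.
  by apply: ev_eq; exact: word_equiv_repr.
exists (fun x => ev (fg_repr x)); split.
  split=> [x y|n]; last by rewrite ev_pi /ev big_seq1.
  have -> : x * y = fg_pi (fg_repr x ++ fg_repr y) by [].
  by rewrite ev_pi /ev big_cat.
move=> f [fM fg]; apply/funext => x; rewrite -{2}(fg_reprK x).
have f1 : f 1 = 1 by apply: (@mulgI _ (f 1)); rewrite -fM !mulg1.
have fV y : f y^-1 = (f y)^-1.
  by apply: (@mulgI _ (f y)); rewrite -fM !mulgV.
elim: (fg_repr x) => [|a u IH]; first by rewrite /ev big_nil -f1.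
have -> : fg_pi (a :: u) = fg_pi [:: a] * fg_pi u by rewrite [RHS]fg_mulE.
rewrite fM -IH /ev big_cons; congr (_ * _).
case: a => n []; rewrite /ev1 /= -fg; last by [].
by rewrite -fV; congr (f _); rewrite [LHS]fg_invE.
Qed.

End FreeGroupUniversal.

Inductive lterm : Type :=
| LVar of nat
| LMeet of lterm & lterm
| LJoin of lterm & lterm.

Fixpoint lterm_encode (t : lterm) : GenTree.tree nat :=
  match t with
  | LVar n => GenTree.Leaf n
  | LMeet s t => GenTree.Node 0 [:: lterm_encode s; lterm_encode t]
  | LJoin s t => GenTree.Node 1 [:: lterm_encode s; lterm_encode t]
  end.

Fixpoint lterm_decode (t : GenTree.tree nat) : option lterm :=
  match t with
  | GenTree.Leaf n => Some (LVar n)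
  | GenTree.Node 0 [:: s; t] =>
      if (lterm_decode s, lterm_decode t) is (Some s', Some t')
      then Some (LMeet s' t') else None
  | GenTree.Node 1 [:: s; t] =>
      if (lterm_decode s, lterm_decode t) is (Some s', Some t')
      then Some (LJoin s' t') else None
  | _ => None
  end.

Lemma lterm_encodeK : pcancel lterm_encode lterm_decode.
Proof. by elim=> [n|s /= -> t -> |s /= -> t ->]. Qed.

HB.instance Definition _ := Countable.copy lterm (pcan_type lterm_encodeK).

(* The least preorder on terms for which [LMeet] and [LJoin] are binary infima
   and suprema; its quotient poset is the free lattice. *)
Inductive lterm_le : lterm -> lterm -> Prop :=
| lterm_le_refl s : lterm_le s s
| lterm_le_trans s t u : lterm_le s t -> lterm_le t u -> lterm_le s u
| lterm_meetl s t : lterm_le (LMeet s t) s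
| lterm_meetr s t : lterm_le (LMeet s t) t
| lterm_meet_glb s t u :
    lterm_le u s -> lterm_le u t -> lterm_le u (LMeet s t)
| lterm_joinl s t : lterm_le s (LJoin s t)
| lterm_joinr s t : lterm_le t (LJoin s t)
| lterm_join_lub s t u :
    lterm_le s u -> lterm_le t u -> lterm_le (LJoin s t) u.

Definition lterm_eqb (s t : lterm) : bool :=
  `[< lterm_le s t /\ lterm_le t s >].

Lemma lterm_eqb_equiv : equiv_class_of lterm_eqb.
Proof.
split=> [s|s t|t s u].
- by apply/asboolP; split; exact: lterm_le_refl.
- by apply/asboolP/asboolP => -[].
- move=> /asboolP[st ts] /asboolP[tu ut]; apply/asboolP; split.
    exact: lterm_le_trans tu.
  exact: lterm_le_trans ts.
Qed.

Canonical lterm_equiv_rel := EquivRelPack lterm_eqb_equiv.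

Definition free_lattice : Type := {eq_quot lterm_equiv_rel}.

HB.instance Definition _ := Choice.on free_lattice.
HB.instance Definition _ := Countable.on free_lattice.

Definition fl_pi (s : lterm) : free_lattice :=
  \pi_({eq_quot lterm_equiv_rel}) s.
Definition fl_repr (x : free_lattice) : lterm :=
  repr (x : {eq_quot lterm_equiv_rel}).

Lemma fl_reprK x : fl_pi (fl_repr x) = x.
Proof. exact: reprK. Qed.

Lemma fl_piP s t : fl_pi s = fl_pi t <-> lterm_le s t /\ lterm_le t s.
Proof.
by split=> [/(eqmodP lterm_equiv_rel s t)/asboolP //|/asboolP h]; exact/(eqmodP lterm_equiv_rel s t).
Qed.

Lemma fl_repr_pi s :
  lterm_le (fl_repr (fl_pi s)) s /\ lterm_le s (fl_repr (fl_pi s)).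
Proof. by apply/fl_piP; rewrite fl_reprK. Qed.

Definition fl_le (x y : free_lattice) : bool :=
  `[< lterm_le (fl_repr x) (fl_repr y) >].
Definition fl_meet (x y : free_lattice) : free_lattice :=
  fl_pi (LMeet (fl_repr x) (fl_repr y)).
Definition fl_join (x y : free_lattice) : free_lattice :=
  fl_pi (LJoin (fl_repr x) (fl_repr y)).

Lemma fl_le_refl : reflexive fl_le.
Proof. by move=> x; apply/asboolP; exact: lterm_le_refl. Qed.

Lemma fl_le_anti : antisymmetric fl_le.
Proof.
move=> x y /andP[/asboolP xy /asboolP yx].
by rewrite -(fl_reprK x) -(fl_reprK y); apply/fl_piP.
Qed.

Lemma fl_le_trans : transitive fl_le.
Proof.
by move=> y x z /asboolP xy /asboolP yz; apply/asboolP; exact: lterm_le_trans yz.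
Qed.

Fact free_lattice_display : Order.disp_t. Proof. exact: Order.Disp tt tt. Qed.

HB.instance Definition _ := Order.Le_isPOrder.Build free_lattice_display
  free_lattice fl_le_refl fl_le_anti fl_le_trans.

Lemma fl_lexI (x y z : free_lattice) :
  (x <= fl_meet y z)%O = (x <= y)%O && (x <= z)%O.
Proof.
have [h1 h2] := fl_repr_pi (LMeet (fl_repr y) (fl_repr z)).
apply/idP/andP => [/asboolP xyz|[/asboolP xy /asboolP xz]].
  have xyz' := lterm_le_trans xyz h1.
  by split; apply/asboolP; apply: lterm_le_trans xyz' _;
    [exact: lterm_meetl | exact: lterm_meetr].
apply/asboolP; apply: lterm_le_trans h2; exact: lterm_meet_glb.
Qed.

Lemma fl_leUx (x y z : free_lattice) :
  (fl_join x y <= z)%O = (x <= z)%O && (y <= z)%O.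
Proof.
have [h1 h2] := fl_repr_pi (LJoin (fl_repr x) (fl_repr y)).
apply/idP/andP => [/asboolP xyz|[/asboolP xz /asboolP yz]].
  have xyz' := lterm_le_trans h2 xyz.
  by split; apply/asboolP; apply: lterm_le_trans xyz';
    [exact: lterm_joinl | exact: lterm_joinr].
apply/asboolP; apply: (lterm_le_trans h1); exact: lterm_join_lub.
Qed.

HB.instance Definition _ := Order.POrder_MeetJoin_isLattice.Build
  free_lattice_display free_lattice fl_lexI fl_leUx.

Definition fl_gen (n : nat) : free_lattice := fl_pi (LVar n).

Lemma fl_piI s t : fl_pi (LMeet s t) = (fl_pi s `&` fl_pi t)%O.
Proof.
have [s1 s2] := fl_repr_pi s; have [t1 t2] := fl_repr_pi t.
apply/fl_piP; split; apply: lterm_meet_glb.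
- exact: lterm_le_trans (lterm_meetl _ _) s2.
- exact: lterm_le_trans (lterm_meetr _ _) t2.
- exact: lterm_le_trans (lterm_meetl _ _) s1.
- exact: lterm_le_trans (lterm_meetr _ _) t1.
Qed.

Lemma fl_piU s t : fl_pi (LJoin s t) = (fl_pi s `|` fl_pi t)%O.
Proof.
have [s1 s2] := fl_repr_pi s; have [t1 t2] := fl_repr_pi t.
apply/fl_piP; split; apply: lterm_join_lub.
- exact: lterm_le_trans s2 (lterm_joinl _ _).
- exact: lterm_le_trans t2 (lterm_joinr _ _).
- exact: lterm_le_trans s1 (lterm_joinl _ _).
- exact: lterm_le_trans t1 (lterm_joinr _ _).
Qed.

Theorem free_lattice_universal (d : Order.disp_t) (L : latticeType d)
    (g : nat -> L) :
  exists! f : free_lattice -> L,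
    [/\ {morph f : x y / (x `&` y)%O}, {morph f : x y / (x `|` y)%O} &
        forall n, f (fl_gen n) = g n].
Proof.
pose ev := fix ev (t : lterm) : L := match t with
  | LVar n => g n
  | LMeet s t => (ev s `&` ev t)%O
  | LJoin s t => (ev s `|` ev t)%O end.
have ev_le s t : lterm_le s t -> (ev s <= ev t)%O.
  elim=> {s t} [//|s t u _ st _ tu|s t|s t|s t u _ us _ ut|s t|s t|s t u _ su _ tu] /=.
  - exact: le_trans tu.
  - exact: leIl.
  - exact: leIr.
  - by rewrite lexI us.
  - exact: leUl.
  - exact: leUr.
  - by rewrite leUx su.
have ev_pi s : ev (fl_repr (fl_pi s)) = ev s.
  by have [h1 h2] := fl_repr_pi s; apply/le_anti; rewrite !ev_le.
exists (fun x => ev (fl_repr x)); split.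
  by split=> [x y|x y|n]; rewrite ?ev_pi //;
     rewrite -[x in LHS]fl_reprK -[y in LHS]fl_reprK -(fl_piI, fl_piU) ev_pi.
move=> f [fI fU fg]; apply/funext => x; rewrite -{2}(fl_reprK x).
elim: (fl_repr x) => [n|s IHs t IHt|s IHs t IHt] /=.
- by rewrite -fg.
- by rewrite fl_piI fI IHs IHt.
- by rewrite fl_piU fU IHs IHt.
Qed.

(* [{malg int[K]}] is the type of finitely supported functions K -> int, and
   [{fmonom nat}] the free monoid on nat; [free_ring] is thus the integral monoid
   ring of that monoid, and [free_abelian] the direct sum of nat copies of Z. *)
Definition free_ring : nzRingType := {malg int[{fmonom nat}]}.

Definition free_abelian : zmodType := {malg int[nat]}.

(* [{ptws T -> bool}] is the power set of [T] with the product topology; each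
   parameter space below, coerced to a type, has the subspace topology. *)

Definition NormalSubgroups (G : groupType) : set {ptws G -> bool} :=
  [set N | group_closed (N : {pred G}) /\
           (forall x y : G, N x -> N (x ^ y)%g)].

Definition TwoSidedIdeals (A : nzRingType) : set {ptws A -> bool} :=
  [set I | zmod_closed (I : {pred A}) /\
           (forall a x : A, I x -> I (a * x)%R /\ I (x * a)%R)].

Definition Subgroups (V : zmodType) : set {ptws V -> bool} :=
  [set H | zmod_closed (H : {pred V})].

Definition LatticeCongruences (d : Order.disp_t) (L : latticeType d)
    : set {ptws (L * L)%type -> bool} :=
  [set theta : {ptws (L * L)%type -> bool} |
    [/\ forall a : L, theta (a, a),
        forall a b : L, theta (a, b) -> theta (b, a),
        forall a b c : L, theta (a, b) -> theta (b, c) -> theta (a, c) &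
        forall a b a' b' : L, theta (a, a') -> theta (b, b') ->
          theta (a `&` b, a' `&` b')%O /\ theta (a `|` b, a' `|` b')%O]].

Arguments NormalSubgroups : clear implicits.
Arguments TwoSidedIdeals : clear implicits.
Arguments Subgroups : clear implicits.
Arguments LatticeCongruences {d} L.

Definition equiv_classes (T : Type) (e : T -> T -> Prop) : set (set T) :=
  range (fun x => [set y | e x y]).

Definition group_quotient (G : groupType) (N : {ptws G -> bool}) :=
  equiv_classes (fun x y : G => N (x^-1 * y)%g).

Definition zmod_quotient (V : zmodType) (H : {ptws V -> bool}) :=
  equiv_classes (fun x y : V => H (y - x)%R).

Definition lattice_quotient (d : Order.disp_t) (L : latticeType d)
    (theta : {ptws (L * L)%type -> bool}) :=
  equiv_classes (fun a b : L => theta (a, b)).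

(* Main.v *)
(* F_sigma: a quotient is finite iff some finite list of elements meets every
   class, and for a fixed list this is a closed condition on the parameter.

   Hardness: an F_sigma subset B of a zero-dimensional Polish space is
   {y | A_y is finite} for subsets A_y of nat such that every {y | n in A_y} is
   clopen: write B as an increasing union of closed sets H_n, split each
   complement of H_n into disjoint clopen sets V_(n, k), and let A_y be the set
   of codes of the pairs (n, k) with y in V_(n, k). To A one attaches the
   quotient that identifies two elements with the same n-th coordinate for all
   n in A, where the coordinates are {0,1}-valued morphisms: parities of
   exponents for groups and abelian groups, values mod 2 at the unit vectors and
   at 0 for rings, values at the unit vectors for lattices. The n-th generators,
   n in A, are pairwise inequivalent, so the quotient is finite iff A is; and
   since the coordinates of a fixed element are eventually constant, each
   membership condition depends on finitely many bits of A. *)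

Require Import Defs.
From HB Require Import structures.
From mathcomp Require Import finmap.
From mathcomp Require Import all_boot all_order all_algebra.
From mathcomp.multinomials Require Import monalg.
From mathcomp Require Import all_classical reals topology sequences.
From mathcomp Require Import borel_hierarchy.

Set Implicit Arguments.
Unset Strict Implicit.
Unset Printing Implicit Defensive.

Import Order.TTheory GRing.Theory Num.Theory.

Local Open Scope classical_set_scope.

(** * Clopen decompositions in zero-dimensional Polish spaces *)

Lemma clopen_bigcap_nat (T : topologicalType) (F : nat -> set T) (m : nat) :
  (forall i, clopen (F i)) -> clopen (\bigcap_(i < m) F i).
Proof.
move=> cF; elim: m => [|m IH].
  by rewrite bigcap_mkord big_ord0; exact: clopenT.
by rewrite bigcap_mkord big_ord_recr /= -bigcap_mkord; exact: clopenI.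
Qed.

(** A clopen basis may be uncountable, so one clopen set is kept for each of countably many
    balls. *)
Lemma open_bigcup_clopen (R : realType) (Y : topologicalType) (U : set Y) :
  polish R Y -> clopen_basis Y -> open U ->
  exists2 F : nat -> set Y, (forall i, clopen (F i)) & U = \bigcup_i F i.
Proof.
move=> [[D /countable_injP[c cinj] dD] [d [[_ _ dsym dtri] dm _]]] [_ basY] oU.
have ball_nbhs x (e : R) : (0 < e)%R -> nbhs x [set y | (d x y < e)%R].
  by move=> e0; apply/dm; exists e.
(* The clopen set attached to (i, n) contains the ball of radius 1/(n+1)
   around the i-th point of the countable dense set. *)
pose Q (p : nat * nat) (V : set Y) := [/\ clopen V, V `<=` U &
  exists2 x, D x /\ c x = p.1 & [set y | (d x y < p.2.+1%:R^-1)%R] `<=` V].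
have /choice[G HG] : forall p, exists V, clopen V /\ V `<=` U /\
    ((exists W, Q p W) -> Q p V).
  move=> p; have [[W QW]|nQ] := pselect (exists W, Q p W).
    by exists W; case: (QW).
  by exists set0; split; [exact: clopen0|split].
exists (fun n => if pickle_inv n is Some p then G p else set0).
  by move=> n; case: pickle_inv => [p|]; [case: (HG p)|exact: clopen0].
apply/seteqP; split=> [x Ux|x [n _]]; last first.
  by case: pickle_inv => [p|//]; case: (HG p) => _ [+ _]; exact.
have [V [cV Vx] VU] : filter_from [set U | clopen U /\ U x] id U.
  by apply: basY; exact: open_nbhs_nbhs.
have /dm[e e0 eV] : nbhs x V by apply: open_nbhs_nbhs; split=> //; case: cV.
(* With radius below [e / 2], the ball about a point [z] that close to [x] stays within distance [e]
   of [x], hence inside [V]. *)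
have [n] : exists n : nat, (n.+1%:R^-1 < e / 2 :> R)%R.
  have [n] := ltr_add_invr (divr_gt0 e0 (ltr0n R 2)).
  by rewrite add0r; exists n.
move=> ne.
have n0 : (0 < n.+1%:R^-1 :> R)%R by rewrite invr_gt0 ltr0n.
have := ball_nbhs x _ n0; rewrite nbhsE => -[O [oO Ox] Oball].
have [z [Oz Dz]] := dD O (ex_intro _ x Ox) oO.
have xz : (d x z < n.+1%:R^-1)%R by exact: Oball.
have QV : Q (c z, n) V.
  split=> //; exists z => // y /= zy; apply: eV => /=.
  rewrite (le_lt_trans (dtri x z y))// (splitr e) ltrD//; exact: lt_trans ne.
exists (pickle (c z, n)) => //; rewrite pickleK_inv.
have [_ [_ /(_ (ex_intro _ _ QV))[_ _ [w [Dw /= cw]]]]] := HG (c z, n).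
have -> : w = z by apply: cinj => //; rewrite inE.
by apply; rewrite /= dsym.
Qed.

(** Removing the finitely many earlier sets from a clopen set leaves it clopen. *)
Lemma open_trivIset_bigcup_clopen (R : realType) (Y : topologicalType)
    (U : set Y) : polish R Y -> clopen_basis Y -> open U ->
  exists F : nat -> set Y,
    [/\ forall i, clopen (F i), trivIset setT F & U = \bigcup_i F i].
Proof.
move=> pY bY oU; have [F cF ->] := open_bigcup_clopen pY bY oU.
exists (seqDU F); split; last by rewrite seqDU_bigcup_eq.
- move=> i; rewrite /seqDU setDE; apply: clopenI => //.
  apply: clopenC => //; rewrite -bigcup_mkord -[X in clopen X]setCK setC_bigcup.
  by apply: clopenC => //; apply: clopen_bigcap_nat => j; exact: clopenC.
- exact: trivIset_seqDU.
Qed.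

Lemma Fsigma_finite_clopen (R : realType) (Y : topologicalType) (B : set Y) :
  polish R Y -> clopen_basis Y -> Fsigma B ->
  exists2 C : nat -> set Y, (forall i, clopen (C i)) &
    forall y, B y <-> finite_set [set i | C i y].
Proof.
move=> pY bY [F cF ->].
pose H n := \bigcup_(i < n.+1) F i.
have oH n : open (~` H n).
  by apply: closed_openC; apply: closed_bigcup => // ; exact: finite_II.
have /choice[V HV] n := open_trivIset_bigcup_clopen pY bY (oH n).
exists (fun i => if pickle_inv i is Some p then V p.1 p.2 else set0).
  move=> i; case: pickle_inv => [[n k]|]; last exact: clopen0.
  by case: (HV n).
move=> y; split=> [[n _ Fny]|fin].
(* [H m] contains [F n] once n <= m, so only levels below [n] contribute an index. *)
- have Vlt m k : V m k y -> (m < n)%N.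
    move=> Vy; rewrite ltnNge; apply/negP => nm.
    have [_ _ HE] := HV m.
    have : (~` H m) y by rewrite HE; exists k.
    by apply; exists n.
  (* Disjointness leaves at most one [k] per level; 0 is a dummy for levels without any. *)
  have uniqk m : exists k0, forall k, V m k y -> k = k0.
    have [_ tV _] := HV m.
    have [[k0 Vk0]|nk] := pselect (exists k, V m k y).
      by exists k0 => k Vk; apply: tV => //; exists y.
    by exists 0 => k Vk; case: nk; exists k.
  have [K HK] := choice uniqk.
  apply: (@sub_finite_set _ _ [set pickle (m, K m) | m in `I_n]).
    move=> i /=; have := @pickle_invK (nat * nat)%type i.
    case: pickle_inv => [[m k]|//] /= <- Vy.
    by exists m; [exact: Vlt Vy|rewrite -(HK _ _ Vy)].
  by apply: finite_image; exact: finite_II.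
- apply: contrapT => nB.
  have exk m : exists k, V m k y.
    have [_ _ HE] := HV m.
    have : (~` H m) y.
      by move=> [i _ Fi]; apply: nB; exists i.
    by rewrite HE => -[k _ Vk]; exists k.
  have [K HK] := choice exk.
  apply: infinite_nat.
  rewrite (_ : setT = (fun m => pickle (m, K m)) @^-1`
      [set i | (if pickle_inv i is Some p then V p.1 p.2 else set0) y]).
    by apply: finite_preimage fin => m m' _ _ /(pcan_inj pickleK)[].
  by apply/esym/seteqP; split=> // m _; rewrite /= pickleK_inv; exact: HK.
Qed.

(** * A general completeness criterion for finite quotients *)

(** Trades finiteness for a finite list of representatives, since such lists can be enumerated when
    [T] is countable. *)
Lemma finite_equiv_classesP (T : eqType) (e : T -> T -> Prop) :
  (forall x, e x x) -> (forall x y, e x y -> e y x) ->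
  (forall x y z, e x y -> e y z -> e x z) ->
  finite_set (equiv_classes e) <->
  exists s : seq T, forall y, exists2 x, x \in s & e x y.
Proof.
move=> er es et; split=> [fin|[s hs]].
  have [[x0]|T0] := pselect (inhabited T); last first.
    by exists [::] => y; case: (T0 (inhabits y)).
  have /choice[r hr] : forall A : set T, exists x, equiv_classes e A -> A x.
    move=> A; have [[x _ <-]|nA] := pselect (equiv_classes e A); last first.
      by exists x0.
    by exists x => _; exact: er.
  have /finite_seqP[s hs] := finite_image r fin.
  exists s => y.
  have Cy : equiv_classes e [set z | e y z] by exists y.
  exists (r [set z | e y z]); last by apply: es; exact: (hr _ Cy).
  have : [set` s] (r [set z | e y z]) by rewrite -hs; exists [set z | e y z].
  by [].
apply: (@sub_finite_set _ _ [set [set z | e x z] | x in [set` s]]).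
  move=> _ [y _ <-]; have [x xs exy] := hs y; exists x => //.
  apply/seteqP; split=> z /=; first exact: et (es _ _ exy).
  exact: et.
by apply: finite_image; apply/finite_seqP; exists s.
Qed.

Section ParameterSpace.
Variables (K : choiceType) (E : set {ptws K -> bool}).

Lemma clopen_param_eval (k : K) : clopen [set N : E | val N k].
Proof.
have ck : continuous (fun N : E => val N k).
  move=> N; apply: (@continuous_comp _ _ _ (fun N : E => val N) (fun f => f k)).
    exact: initial_continuous.
  exact: (@proj_continuous K (fun=> bool)).
have cb : clopen [set b : bool | b].
  by split; [exact: discrete_open|exact: discrete_closed].
exact: (preimage_clopen cb ck).
Qed.

(** A subbasic open set constrains a single bit, and a clopen condition makes both values of that
    bit open. *)
Lemma continuous_param (Y : topologicalType) (f : Y -> E) :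
  (forall k, clopen [set y | val (f y) k]) -> continuous f.
Proof.
move=> cf; apply: continuous_comp_initial => y; apply/cvg_sup => k.
move=> U [_ [[V oV <-] /= Vk] VU].
pose b := val (f y) k.
have cb : open [set z | val (f z) k = b].
  case: b (erefl b) => _; first by case: (cf k).
  rewrite (_ : [set _ | _] = ~` [set y | val (f y) k]); last first.
    by apply/seteqP; split=> z /=; [move=> ->|move/negP/negbTE].
  by apply: closed_openC; case: (cf k).
apply: (@filterS _ (nbhs y) _ [set z | val (f z) k = b]).
  move=> z zb; apply: VU; change (V (val (f z) k)).
  by rewrite (zb : val (f z) k = b).
by apply: open_nbhs_nbhs.
Qed.

(** [c x y] is the position of the bit that decides whether [x] and [y] are identified. *)
Variables (T : choiceType) (c : T -> T -> K).

Hypothesis Eequiv : forall N, E N ->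
  [/\ forall x, N (c x x), forall x y, N (c x y) -> N (c y x) &
      forall x y z, N (c x y) -> N (c y z) -> N (c x z)].

Lemma Fsigma_finite_quotient : countable [set: T] ->
  Fsigma [set N : E | finite_set (equiv_classes (fun x y => val N (c x y)))].
Proof.
move=> /countable_injP[p pinj].
pose F (s : seq T) :=
  \bigcap_y \bigcup_(x in [set` s]) [set N : E | val N (c x y)].
have cF s : closed (F s).
  apply: closed_bigI => y _; apply: closed_bigcup => [|x _].
    by apply/finite_seqP; exists s.
  by case: (clopen_param_eval (c x y)).
pose code (s : seq T) := pickle (map p s).
(* The second factor empties the indices that code no list, where the intersection alone would be
   everything. *)
exists (fun i => \bigcap_(s in [set s | code s = i]) F s `&`
                 [set N | exists s, code s = i]).
  move=> i; apply: closedI; first by apply: closed_bigI => s _.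
  have [ex|nex] := pselect (exists s, code s = i).
    by rewrite (_ : [set _ | _] = setT) ?predeqE//; exact: closedT.
  by rewrite (_ : [set _ | _] = set0) ?predeqE//; exact: closed0.
have codeI : injective code.
  move=> s t /(pcan_inj pickleK); apply: inj_map => x y.
  by apply: pinj; rewrite inE.
apply/seteqP; split=> N /=; have [er es et] := Eequiv (set_mem (valP N)).
  move=> /(finite_equiv_classesP er es et)[s hs].
  exists (code s) => //; split; last by exists s.
  by move=> t /codeI -> y _; have [x xs xy] := hs y; exists x.
move=> [i _ [+ [s si]]] => /(_ _ si) Fs.
apply/(finite_equiv_classesP er es et); exists s => y.
by have [x xs xy] := Fs y I; exists x.
Qed.

(** [phi (Some n)] is the n-th coordinate, [phi None] its limit in [n], and [g n] the n-th
    generator. *)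
Variables (phi : option nat -> T -> bool) (g : nat -> T).

Hypothesis c_surj : forall k, exists x y, k = c x y.

Hypothesis phi_gen : forall m n, phi (Some m) (g n) = (m == n).

Hypothesis phi_tail :
  forall x, exists m, forall n, (m <= n)%N -> phi (Some n) x = phi None x.

(* The limit coordinate [None] is always required to agree: without it,
   identifying two elements whose limits differ (in the ring case, two constants
   of different parity) would depend on infinitely many bits of A. *)
Definition agree (A : set nat) (x y : T) :=
  phi None x = phi None y /\ forall n, A n -> phi (Some n) x = phi (Some n) y.

Hypothesis phi_param : forall A : set nat, exists2 N, E N &
  forall x y, N (c x y) <-> agree A x y.

(** For [m] in [A], coordinate [m] tells [g m] from all other generators. Conversely, for finite
    [A], a class is fixed by finitely many bits. *)
Lemma finite_agreeP (A : set nat) :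
  finite_set (equiv_classes (agree A)) <-> finite_set A.
Proof.
split=> [fin|/finite_seqP[s As]].
  (* The clause [A n] makes [cl n] empty off [A], so it is a class exactly when [A n]. *)
  pose cl n := [set y | A n /\ agree A (g n) y].
  have clA n : A n -> cl n = [set y | agree A (g n) y].
    by move=> An; apply/seteqP; split=> y //= -[].
  have Acl n : equiv_classes (agree A) (cl n) -> A n.
    by move=> [x _ xn]; have [] : cl n x by rewrite -xn.
  rewrite (_ : A = cl @^-1` equiv_classes (agree A)).
    apply: finite_preimage fin => m n; rewrite !inE => /Acl Am /Acl An mn.
    have [_ [_ /(_ m Am)]] : cl m (g n) by rewrite mn; split.
    by rewrite !phi_gen eqxx => /esym/eqP.
  apply/seteqP; split=> n; last exact: Acl.
  by move=> An; rewrite /preimage/= clA//; exists (g n).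
pose cl (b : bool * (size s).-tuple bool) :=
  [set y | phi None y = b.1 /\ map (fun n => phi (Some n) y) s = b.2].
apply: (@sub_finite_set _ _ (range cl)); last exact/finite_image/finite_finset.
move=> _ [x _ <-].
exists (phi None x, map_tuple (fun n => phi (Some n) x) (in_tuple s)) => //.
apply/seteqP; split=> y /= [e0 e]; split; rewrite ?e0//.
  by move=> n; rewrite As => ns; move/eq_in_map: e => /(_ n ns).
by apply/eq_in_map => n ns; rewrite e// As.
Qed.

Lemma Sigma02_complete_finite_quotient (R : realType) : countable [set: T] ->
  Sigma02_complete R
    [set N : E | finite_set (equiv_classes (fun x y => val N (c x y)))].
Proof.
move=> cT; split; first exact: Fsigma_finite_quotient.
move=> Y pY bY B /(Fsigma_finite_clopen pY bY)[C cC BC].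
have /choice[N HN] : forall A : set nat, exists N : E,
    forall x y, val N (c x y) <-> agree A x y.
  by move=> A; have [N EN HN] := phi_param A; exists (SigSub (mem_set EN)).
exists (fun y => N [set i | C i y]).
  apply: continuous_param => k; have [x [x' ->]] := c_surj k.
  have [m hm] := phi_tail x; have [m' hm'] := phi_tail x'.
  (* Different limits keep the bit off for every [y]. *)
  have [e0|ne0] := eqVneq (phi None x) (phi None x'); last first.
    rewrite (_ : [set _ | _] = set0); first exact: clopen0.
    by rewrite predeqE => y; split=> // /HN[e _]; move: ne0; rewrite e eqxx.
  (* Past both thresholds the coordinates of [x] and [x'] equal the common limit; only a smaller [i]
     where they differ must be kept out of the set attached to [y]. *)
  rewrite (_ : [set _ | _] = \bigcap_(i < maxn m m')
      (if phi (Some i) x == phi (Some i) x' then setT else ~` C i)).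
    apply: clopen_bigcap_nat => i.
    by case: ifP => _; [exact: clopenT|exact: clopenC].
  apply/seteqP; split=> y /=.
    move=> /HN[_ hn] i _; case: eqP => // ne Ciy; apply: ne; exact: hn.
  move=> H; apply/HN; split=> // n Cn.
  have [nm|mn] := ltnP n (maxn m m').
    by have := H n nm; case: eqP.
  by move: mn; rewrite geq_max => /andP[mn mn']; rewrite hm// hm'.
apply/seteqP; split=> y /=;
  rewrite (_ : (fun x x' => _) = agree [set i | C i y]);
  try by apply/funext => x; apply/funext => x'; apply/propext/HN.
- by move=> /finite_agreeP/BC.
- by move=> /BC/finite_agreeP.
Qed.

End ParameterSpace.

(** * Countability, and parities of finitely supported functions *)

Lemma countable_countType (T : countType) : countable [set: T].
Proof.
by apply/countable_injP; exists pickle => x y _ _ /(pcan_inj pickleK).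
Qed.

(** The list of coded support points with their coefficients determines the element. *)
Lemma countable_malg (K : choiceType) :
  countable [set: K] -> countable [set: {malg int[K]}].
Proof.
move=> /countable_injP[p pinj].
have {}pinj : injective p by move=> x y; apply: pinj; rewrite inE.
pose code (v : {malg int[K]}) := pickle [seq (p k, v@_k) | k <- msupp v].
apply/countable_injP; exists code => v w _ _ /(pcan_inj pickleK) vw.
have sub (v1 v2 : {malg int[K]}) k : [seq (p k, v1@_k) | k <- msupp v1] =
    [seq (p k, v2@_k) | k <- msupp v2] -> k \in msupp v1 -> v1@_k = v2@_k.
  move=> e kv; have : (p k, v1@_k) \in [seq (p k, v2@_k) | k <- msupp v2].
    by rewrite -e; apply/mapP; exists k.
  by move=> /mapP[k' _ [/pinj <-]].
apply/malgP => k; have [kv|kv] := boolP (k \in msupp v); first exact: sub.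
have [kw|kw] := boolP (k \in msupp w); first by apply/esym; exact: sub.
by rewrite !mcoeff_outdom.
Qed.

Lemma countable_fmonom (I : countType) : countable [set: {fmonom I}].
Proof.
apply/countable_injP; exists (fun m => pickle (m : seq I)) => m m' _ _.
by move=> /(pcan_inj pickleK)/val_inj.
Qed.

Section MalgParity.
Variables (K : choiceType) (h : K -> bool).

(** With [bool] as the field of two elements, this reduces coefficients mod 2 and extends [h]
    linearly. *)
Definition parity (v : {malg int[K]}) : bool := mmap (intr : int -> bool) h v.

Lemma parityB : {morph parity : v w / (v - w)%R >-> (v - w)%R}.
Proof. exact: mmapB. Qed.

Lemma parityU k : parity << k >>%R = h k.
Proof. by rewrite /parity mmapU mul1r. Qed.

End MalgParity.

Lemma parity_eq (K : choiceType) (h h' : K -> bool) (v : {malg int[K]}) :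
  {in msupp v, h =1 h'} -> parity h v = parity h' v.
Proof.
move=> hh; rewrite /parity !mmapE; apply: eq_big_seq => k kv.
by rewrite hh.
Qed.

Lemma parity_tail (K : choiceType) (h : option nat -> K -> bool)
    (h_tail : forall k, exists m,
      forall n, (m <= n)%N -> h (Some n) k = h None k)
    (v : {malg int[K]}) :
  exists m, forall n, (m <= n)%N -> parity (h (Some n)) v = parity (h None) v.
Proof.
have [m hm] := choice h_tail.
exists (\max_(k <- msupp v) m k)%N => n mn; apply: parity_eq => k kv.
by apply: hm; apply: leq_trans mn; exact: leq_bigmax_seq.
Qed.

(** * Agreement as congruence modulo a common kernel *)

Section ZmodAgree.
Variables (V : zmodType) (phi : option nat -> V -> bool).
Hypothesis phiB : forall n, {morph phi n : x y / (x - y)%R >-> (x - y)%R}.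

Lemma agree0_sub (A : set nat) x y :
  agree phi A 0%R (y - x)%R <-> agree phi A x y.
Proof.
have eqB n : phi n 0%R = phi n (y - x)%R <-> phi n x = phi n y.
  rewrite -(subrr 0%R) !phiB subrr; split=> [/esym/subr0_eq //|->].
  by rewrite subrr.
by split=> -[/eqB h0 h]; split=> // n /h /eqB.
Qed.

Lemma agree0_subP (A : set nat) x y :
  `[< agree phi A 0%R (y - x)%R >] <-> agree phi A x y.
Proof. by split=> [/asboolP/agree0_sub|/agree0_sub/asboolP].  Qed.

Lemma agree0_zmod_closed (A : set nat) :
  zmod_closed (fun v => `[< agree phi A 0%R v >] : bool).
Proof.
split=> [|x y /asboolP[x0 hx] /asboolP[y0 hy]]; apply/asboolP; first by [].
apply/agree0_sub; split=> [|n An]; first by rewrite -y0.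
by rewrite -hy// hx.
Qed.

Lemma zmod_closed_equiv (H : {pred V}) : zmod_closed H ->
  [/\ forall x, H (x - x)%R, forall x y, H (y - x)%R -> H (x - y)%R &
      forall x y z, H (y - x)%R -> H (z - y)%R -> H (z - x)%R].
Proof.
move=> [H0 HB].
have HN x y : H (y - x)%R -> H (x - y)%R.
  by move=> /(HB _ _ H0); rewrite sub0r opprB.
split=> [x||x y z /HN Hyx Hzy] //; first by rewrite subrr.
by have := HB _ _ Hzy Hyx; rewrite opprB addrA subrK.
Qed.

End ZmodAgree.

Section GroupAgree.
Local Open Scope group_scope.
Variables (G : groupType) (phi : option nat -> G -> bool).
Hypothesis phiM : forall n, {morph phi n : x y / x * y >-> x (+) y}.

Lemma parity1g n : phi n 1 = false.
Proof. by have := phiM n 1 1; rewrite mulg1; case: (phi n 1). Qed.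

Lemma parityVg n x : phi n x^-1 = phi n x.
Proof.
by have := phiM n x x^-1; rewrite mulgV parity1g; do 2!case: (phi n _).
Qed.

Lemma agree1_div (A : set nat) x y :
  agree phi A 1 (x^-1 * y) <-> agree phi A x y.
Proof.
have eqM n : phi n 1 = phi n (x^-1 * y) <-> phi n x = phi n y.
  by rewrite parity1g phiM parityVg; case: (phi n x); case: (phi n y).
by split=> -[/eqM h0 h]; split=> // n /h /eqM.
Qed.

Lemma agree1_divP (A : set nat) x y :
  `[< agree phi A 1 (x^-1 * y) >] <-> agree phi A x y.
Proof. by split=> [/asboolP/agree1_div|/agree1_div/asboolP]. Qed.

(** This is a common kernel of homomorphisms to Z/2; conjugation does not change a parity. *)
Lemma agree1_normal (A : set nat) :
  NormalSubgroups G (fun x => `[< agree phi A 1 x >]).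
Proof.
have E x : agree phi A 1 x <->
    ~~ phi None x /\ forall n, A n -> ~~ phi (Some n) x.
  rewrite /agree parity1g; split=> -[x0 hx].
    by split=> [|n An]; [rewrite -x0|rewrite -hx// parity1g].
  by split=> [|n An]; [case: phi x0|rewrite parity1g; case: phi (hx _ An)].
split; first split.
- exact/asboolP.
- move=> x y /asboolP/E[x0 hx] /asboolP/E[y0 hy]; apply/asboolP/E.
  split=> [|n An]; rewrite phiM parityVg.
    by rewrite (negbTE x0) (negbTE y0).
  by rewrite (negbTE (hx _ An)) (negbTE (hy _ An)).
- move=> x y /asboolP/E[x0 hx]; apply/asboolP/E.
  split=> [|n An]; rewrite conjgE !phiM parityVg.
    by rewrite (negbTE x0); case: phi.
  by rewrite (negbTE (hx _ An)); case: phi.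
Qed.

Lemma normal_equiv (N : {pred G}) : NormalSubgroups G N ->
  [/\ forall x, N (x^-1 * x), forall x y, N (x^-1 * y) -> N (y^-1 * x) &
      forall x y z, N (x^-1 * y) -> N (y^-1 * z) -> N (x^-1 * z)].
Proof.
move=> [[N1 NV] _].
have HN x y : N (x^-1 * y) -> N (y^-1 * x).
  by move=> /(NV _ _ N1); rewrite mul1g invgM invgK.
split=> [x||x y z Hxy /HN Hzy] //; first by rewrite mulVg.
by have := NV _ _ Hxy Hzy; rewrite invgM invgK mulgA mulgK.
Qed.

End GroupAgree.

(** * Rings *)

(** The value of a monomial at the n-th unit vector, or at the origin for [None]; the empty word has
    value 1. *)
Definition var_word (n : option nat) (m : {fmonom nat}) : bool :=
  all (fun k => Some k == n) m.

Lemma var_word_mmorphism n : mmorphism (var_word n).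
Proof.
split=> [x y|]; last by rewrite /var_word fm1.
by rewrite /var_word fmM all_cat.
Qed.

HB.instance Definition _ n :=
  isMultiplicative.Build {fmonom nat} bool (var_word n) (var_word_mmorphism n).

Lemma var_word_tail m :
  exists N, forall n, (N <= n)%N -> var_word (Some n) m = var_word None m.
Proof.
(* The successor puts [n] strictly above every letter of [m]. *)
exists (\max_(k <- fmonom_val m) k.+1)%N => n Nn; apply: eq_in_all => k km.
apply/negbTE/negP => /eqP[kn]; move: Nn; rewrite -kn leqNgt => /negP; apply.
by apply: leq_bigmax_seq km _.
Qed.

(* The value mod 2 of a noncommutative polynomial at the n-th unit vector, and
   at the origin for [None]. *)
Definition ring_parity (n : option nat) : free_ring -> bool :=
  parity (var_word n).

Lemma ring_parityB n :
  {morph ring_parity n : v w / (v - w)%R >-> (v - w)%R}.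
Proof. exact: parityB. Qed.

Lemma ring_parityM n :
  {morph ring_parity n : v w / (v * w)%R >-> (v * w)%R}.
Proof. exact: rmorphM. Qed.

Lemma agree0_ideal (A : set nat) :
  TwoSidedIdeals free_ring (fun v => `[< agree ring_parity A 0%R v >]).
Proof.
split; first exact: (agree0_zmod_closed ring_parityB).
have par0 n : ring_parity n 0%R = 0%R.
  by rewrite -(subrr 0%R) ring_parityB subrr.
move=> a x /asboolP[x0 hx].
by split; apply/asboolP; split=> [|n An] /=;
  rewrite par0 ring_parityM -?x0 -?hx// par0 ?mulr0 ?mul0r.
Qed.

Lemma Sigma02_complete_finite_ring (R : realType) :
  Sigma02_complete R
    [set I : TwoSidedIdeals free_ring | finite_set (zmod_quotient (val I))].
Proof.
apply: (@Sigma02_complete_finite_quotient _ _ free_ring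
  (fun x y => y - x)%R _ ring_parity (fun n => << fmu n >>%R)).
- by move=> I [/zmod_closed_equiv].
- by move=> k; exists 0%R, k; rewrite subr0.
- move=> m n; rewrite /ring_parity parityU /var_word fmU /= andbT.
  by rewrite (inj_eq Some_inj) eq_sym.
- exact: parity_tail var_word_tail.
- move=> A; exists (fun x => `[< agree ring_parity A 0%R x >]).
    exact: agree0_ideal.
  exact: (agree0_subP ring_parityB).
- exact/countable_malg/countable_fmonom.
Qed.

(** * Abelian groups *)

(** The coefficient of e_n mod 2; for [None] no key matches, which gives the zero map. *)
Definition abelian_parity (n : option nat) : free_abelian -> bool :=
  parity (fun k => Some k == n).

Lemma abelian_parityB n :
  {morph abelian_parity n : v w / (v - w)%R >-> (v - w)%R}.
Proof. exact: parityB. Qed.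

Lemma Sigma02_complete_finite_abelian (R : realType) :
  Sigma02_complete R
    [set H : Subgroups free_abelian | finite_set (zmod_quotient (val H))].
Proof.
apply: (@Sigma02_complete_finite_quotient _ _ free_abelian
  (fun x y => y - x)%R _ abelian_parity (fun n => << n >>%R)).
- exact: zmod_closed_equiv.
- by move=> k; exists 0%R, k; rewrite subr0.
- by move=> m n; rewrite /abelian_parity parityU (inj_eq Some_inj) eq_sym.
- move=> v; apply: (parity_tail (h := fun n k => Some k == n)) => k.
  exists k.+1 => n kn.
  by apply/negbTE/negP => /eqP[e]; move: kn; rewrite e ltnn.
- move=> A; exists (fun x => `[< agree abelian_parity A 0%R x >]).
    exact: (agree0_zmod_closed abelian_parityB).
  exact: (agree0_subP abelian_parityB).
- exact/countable_malg/countable_countType.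
Qed.

(** * Groups *)

(** The exponent sum of x_n mod 2, where a letter and its inverse count alike. *)
Definition letter_parity (n : option nat) (u : word) : bool :=
  odd (count (fun a : letter => Some a.1 == n) u).

Lemma letter_parity_equiv n u v :
  word_equiv u v -> letter_parity n u = letter_parity n v.
Proof.
elim=> {u v} [u a v|//|u v _ ->//|u v w _ -> _ ->//].
rewrite /letter_parity !count_cat /= !oddD.
by case: (_ == n) => /=; do 2!case: odd.
Qed.

Definition fg_parity (n : option nat) (x : free_group) : bool :=
  letter_parity n (fg_repr x).

Lemma fg_parity_pi n u : fg_parity n (fg_pi u) = letter_parity n u.
Proof. exact/letter_parity_equiv/word_equiv_repr. Qed.

Lemma fg_parityM n : {morph fg_parity n : x y / (x * y)%g >-> x (+) y}.
Proof.
by move=> x y; rewrite [LHS]fg_parity_pi /letter_parity count_cat oddD.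
Qed.

Lemma fg_parity_tail x :
  exists m, forall n, (m <= n)%N -> fg_parity (Some n) x = fg_parity None x.
Proof.
exists (\max_(a <- fg_repr x) a.1.+1)%N => n mn.
congr odd; apply: eq_in_count => a au /=; apply/negbTE/negP => /eqP[an].
move: mn; rewrite -an leqNgt => /negP; apply.
exact: (@leq_bigmax_seq _ _ _ (fun a : letter => a.1.+1) _ au).
Qed.

Lemma Sigma02_complete_finite_group (R : realType) :
  Sigma02_complete R
    [set N : NormalSubgroups free_group | finite_set (group_quotient (val N))].
Proof.
apply: (@Sigma02_complete_finite_quotient _ _ free_group
  (fun x y => x^-1 * y)%g _ fg_parity fg_gen).
- exact: normal_equiv.
- by move=> k; exists 1%g, k; rewrite invg1 mul1g.
- move=> m n; rewrite fg_parity_pi /letter_parity /= addn0 oddb.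
  by rewrite (inj_eq Some_inj) eq_sym.
- exact: fg_parity_tail.
- move=> A; exists (fun x => `[< agree fg_parity A 1%g x >]).
    exact: (agree1_normal fg_parityM).
  exact: (agree1_divP fg_parityM).
- exact: countable_countType.
Qed.

(** * Lattices *)

Fixpoint lterm_eval (p : pred nat) (t : lterm) : bool :=
  match t with
  | LVar n => p n
  | LMeet s t => lterm_eval p s && lterm_eval p t
  | LJoin s t => lterm_eval p s || lterm_eval p t
  end.

(** The two-element lattice satisfies every rule generating [lterm_le], so evaluation descends to
    the free lattice. *)
Lemma lterm_eval_le p s t : lterm_le s t -> lterm_eval p s -> lterm_eval p t.
Proof.
elim=> {s t} //=.
- by move=> s t u _ st _ tu /st.
- by move=> s t /andP[].
- by move=> s t /andP[].
- by move=> s t u _ us _ ut hu; rewrite us ?ut.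
- by move=> s t ->.
- by move=> s t ->; rewrite orbT.
- by move=> s t u _ su _ tu /orP[/su|/tu].
Qed.

(** The homomorphism to the two-element lattice sending only the n-th generator to [true]; [None]
    sends all generators to [false]. *)
Definition fl_eval (n : option nat) (x : free_lattice) : bool :=
  lterm_eval (fun k => Some k == n) (fl_repr x).

Lemma fl_eval_pi n t :
  fl_eval n (fl_pi t) = lterm_eval (fun k => Some k == n) t.
Proof.
by have [h1 h2] := fl_repr_pi t; apply/idP/idP; exact: lterm_eval_le.
Qed.

Lemma fl_evalI n : {morph fl_eval n : x y / (x `&` y)%O >-> x && y}.
Proof. by move=> x y; rewrite [LHS]fl_eval_pi. Qed.

Lemma fl_evalU n : {morph fl_eval n : x y / (x `|` y)%O >-> x || y}.
Proof. by move=> x y; rewrite [LHS]fl_eval_pi. Qed.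

Lemma fl_eval_tail x :
  exists m, forall n, (m <= n)%N -> fl_eval (Some n) x = fl_eval None x.
Proof.
rewrite /fl_eval.
elim: (fl_repr x) => [k|s [m hm] t [m' hm']|s [m hm] t [m' hm']] /=.
- exists k.+1 => n kn; apply/negbTE/negP => /eqP[e].
  by move: kn; rewrite e ltnn.
- exists (maxn m m') => n; rewrite geq_max => /andP[mn mn'].
  by rewrite hm// hm'.
- exists (maxn m m') => n; rewrite geq_max => /andP[mn mn'].
  by rewrite hm// hm'.
Qed.

Lemma agree_congruence (A : set nat) :
  LatticeCongruences free_lattice (fun p => `[< agree fl_eval A p.1 p.2 >]).
Proof.
split=> [a|a b|a b c|a b a' b'].
- exact/asboolP.
- by move=> /asboolP[h0 h]; apply/asboolP; split=> // n /h.
- move=> /asboolP[h0 h] /asboolP[h0' h']; apply/asboolP.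
  by split=> [|n An]; [rewrite h0|rewrite h// h'].
- move=> /asboolP[/= h0 h] /asboolP[/= h0' h'].
  by split; apply/asboolP; split=> [|n An] /=;
    rewrite (fl_evalI, fl_evalU) (fl_evalI, fl_evalU) ?h0 ?h0' ?h ?h'.
Qed.

Lemma Sigma02_complete_finite_lattice (R : realType) :
  Sigma02_complete R
    [set theta : LatticeCongruences free_lattice |
       finite_set (lattice_quotient (val theta))].
Proof.
apply: (@Sigma02_complete_finite_quotient _ _ free_lattice
  pair _ fl_eval fl_gen).
- by move=> theta [].
- by move=> [x y]; exists x, y.
- by move=> m n; rewrite fl_eval_pi /= (inj_eq Some_inj) eq_sym.
- exact: fl_eval_tail.
- move=> A; exists (fun p => `[< agree fl_eval A p.1 p.2 >]).
    exact: agree_congruence.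
  by move=> x y; split=> /asboolP.
- exact: countable_countType.
Qed.

Theorem theorem12p7 (R : realType) :
  [/\ Sigma02_complete R
        [set N : NormalSubgroups free_group | finite_set (group_quotient (val N))],
      Sigma02_complete R
        [set I : TwoSidedIdeals free_ring | finite_set (zmod_quotient (val I))],
      Sigma02_complete R
        [set H : Subgroups free_abelian | finite_set (zmod_quotient (val H))] &
      Sigma02_complete R
        [set theta : LatticeCongruences free_lattice |
           finite_set (lattice_quotient (val theta))]].
Proof.
split.
- exact: Sigma02_complete_finite_group.
- exact: Sigma02_complete_finite_ring.
- exact: Sigma02_complete_finite_abelian.
- exact: Sigma02_complete_finite_lattice.
Qed.
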